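(* Let $\{P^{[n]}\in\mathbb{R}^{n\times n}\}_{n\in\mathbb{N}}$ be a sequence of primitive stochastic matrices of increasing dimensions. If $$\lim_{n\to\infty}\ \sup_{k\in\mathbb{N}}\Big\|\tfrac{1}{n}(P^{[n]})^k\Big\|_1\,\tau_{\mathrm{mix}}(P^{[n]})=0,$$ then the sequence is uniformly wise, i.e. $\sup_{k\in\mathbb{N}}|\mathrm{ave}(x^{[n]}(k))-\mu|\to 0$ in probability as $n\to\infty$.
   Context: A matrix $P\in\mathbb{R}^{n\times n}$ is stochastic if $P\ge0$ and $P\mathbf{1}_n=\mathbf{1}_n$; primitive if its associated directed graph (edge $(i,j)$ iff $P_{ij}>0$) is strongly connected and aperiodic. $\|P\|_1=\max_j\sum_i P_{ij}$ (maximum column sum). The mixing time of a primitive stochastic $P$ is $\tau_{\mathrm{mix}}(P)=\inf\{t\in\mathbb{N}:\max_{i,j}\sum_{k}|(P^t)_{ik}-(P^t)_{jk}|\le 1/e\}$. For $x\in\mathbb{R}^n$, $\mathrm{ave}(x)=\frac1n\sum_i x_i$. Setting: for each $n$, $x^{[n]}_i(0)=\mu+\xi^{[n]}_i(0)$ with $\mu\in\mathbb{R}$ fixed and $\xi^{[n]}_1(0),\dots,\xi^{[n]}_n(0)$ independent Gaussian with mean $0$ and common finite variance $\sigma^2$; and $x^{[n]}(k+1)=P^{[n]}x^{[n]}(k)$ for $k\ge0$. *)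

(* Defs.v *)
From HB Require Import structures.
From mathcomp Require Import all_boot all_order all_algebra.
From mathcomp Require Import all_classical all_reals all_analysis.
Set Implicit Arguments. Unset Strict Implicit. Unset Printing Implicit Defensive.
Import Order.TTheory GRing.Theory Num.Theory.
Import numFieldNormedType.Exports.
Local Open Scope classical_set_scope.
Local Open Scope ring_scope.

Section Defs.
Context {R : realType}.

Definition stochastic n (A : 'M[R]_n) : Prop :=
  (forall i j, 0 <= A i j) /\ (forall i, \sum_(j < n) A i j = 1).

Definition adj n (A : 'M[R]_n) : rel 'I_n := fun i j => 0 < A i j.

Definition strongly_connected n (A : 'M[R]_n) : Prop :=
  forall i j, connect (adj A) i j.

(* aperiodic: the gcd of the lengths of all closed walks (cycles) is 1, i.e.
   the only common divisor of all cycle lengths is 1 *)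
Definition aperiodic n (A : 'M[R]_n) : Prop :=
  forall d : nat,
    (forall (i : 'I_n) (s : seq 'I_n),
        path (adj A) i s -> last i s = i -> (0 < size s)%N -> (d %| size s)%N) ->
    d = 1%N.

Definition primitive n (A : 'M[R]_n) : Prop :=
  strongly_connected A /\ aperiodic A.

Definition norm1 n (A : 'M[R]_n) : R :=
  \big[Num.max/0]_(j < n) \sum_(i < n) `|A i j|.

Definition mix_dist n (A : 'M[R]_n) (t : nat) : R :=
  \big[Num.max/0]_(i < n) \big[Num.max/0]_(j < n)
     \sum_(k < n) `|(A ^+ t) i k - (A ^+ t) j k|.

Definition mix_pred n (A : 'M[R]_n) : pred nat :=
  fun t => mix_dist A t <= (expR 1)^-1.

(* tau_mix A = inf { t in N | mix_dist A t <= 1/e } (0 if the set is empty,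
   which does not happen for primitive stochastic matrices) *)
Definition tau_mix n (A : 'M[R]_n) : nat :=
  match pselect (exists t, mix_pred A t) with
  | left H => ex_minn H
  | right _ => 0%N
  end.

Definition sup_pow_norm1 n (A : 'M[R]_n) : R :=
  sup [set norm1 ((n%:R)^-1 *: A ^+ k) | k in [set: nat]].

Definition ave n (x : 'cV[R]_n) : R := (n%:R)^-1 * \sum_(i < n) x i ord0.

Definition traj n (A : 'M[R]_n) (x0 : 'cV[R]_n) (k : nat) : 'cV[R]_n :=
  iter k (fun v => A *m v) x0.

(* Gaussian law with mean m and variance s^2 (degenerate point mass if s = 0) *)
Definition gauss_law (m s : R) : set R -> \bar R :=
  fun A => if s == 0 then (\d_m : set R -> \bar R) A else normal_prob m s A.

End Defs.

Definition mutually_independent {R : realType} (d : measure_display)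
  (T : measurableType d) (Pr : probability T R) n (X : 'I_n -> {RV Pr >-> R}) : Prop :=
  forall B : 'I_n -> set R, (forall i, measurable (B i)) ->
    Pr (\bigcap_(i in [set: 'I_n]) (X i @^-1` B i)) =
    (\prod_(i < n) Pr (X i @^-1` B i))%E.

Definition init {R : realType} (d : measure_display) (T : measurableType d)
  (Pr : probability T R) n (mu : R) (X : 'I_n -> {RV Pr >-> R}) (w : T) : 'cV[R]_n :=
  \col_(i < n) (mu + X i w).

(* Main.v *)
Require Import Defs.
From HB Require Import structures.
From mathcomp Require Import all_boot all_order all_algebra ring lra.
From mathcomp Require Import all_classical all_reals all_analysis measurable_realfun.
Import Order.TTheory GRing.Theory Num.Theory.
Import numFieldNormedType.Exports.
Local Open Scope classical_set_scope.
Local Open Scope ring_scope.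

(* Write [w k = (1/n) 1^T P^k], so that [ave (x k) - mu = w k . xi], and let [s]
   bound all entries of all [w k]. As [w k] is a probability vector,
   [Var (w k . xi) = O(s)], and [|w N - w k|_2^2 <= s |w N - w k|_1 <= 2 s m k]
   for [k <= N], where the mixing distance [m] is submultiplicative and
   [m tau <= 1/e], hence [\sum_k m k <= 4 tau]. Comparing every [w k . xi],
   [k <= N], with the single variable [w N . xi], Chebyshev's inequality and a
   union bound give a tail probability [O(s tau / eps^2)] uniformly in [N]. *)

(** * Mixing distance: contraction, submultiplicativity, summation *)

Definition l1 {R : realType} {n} (v : 'rV[R]_n) : R := \sum_j `|v 0 j|.

Lemma mix_dist_ub {R : realType} {n} (A : 'M[R]_n) t i j :
  l1 (row i (A ^+ t) - row j (A ^+ t)) <= mix_dist A t.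
Proof.
rewrite /mix_dist (bigD1_ord i)//=; rewrite le_max; apply/orP; left.
rewrite (bigD1_ord j)//= le_max; apply/orP; left.
by apply: ler_sum => k _; rewrite !mxE.
Qed.

Lemma mix_dist_le {R : realType} {n} (A : 'M[R]_n) t c : 0 <= c ->
  (forall i j, l1 (row i (A ^+ t) - row j (A ^+ t)) <= c) -> mix_dist A t <= c.
Proof.
move=> c0 H; apply: bigmax_le => // i _; apply: bigmax_le => // j _.
by apply: le_trans (H i j); apply: ler_sum => k _; rewrite !mxE.
Qed.

Lemma mix_dist_ge0 {R : realType} {n} (A : 'M[R]_n) t : 0 <= mix_dist A t.
Proof. exact: bigmax_ge_id. Qed.

(* Since the entries of [v] sum to zero, [v M] only involves differences of
   rows of [M]. *)
Lemma l1_mul_mix_dist {R : realType} {n} (A : 'M[R]_n) t (v : 'rV[R]_n) :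
  \sum_j v 0 j = 0 -> l1 (v *m A ^+ t) <= l1 v * mix_dist A t.
Proof.
case: n A v => [|n] A v v0.
  by rewrite /l1 !big_ord0 mul0r.
have -> : v *m A ^+ t = \sum_i v 0 i *: (row i (A ^+ t) - row 0 (A ^+ t)).
  under eq_bigr do rewrite scalerBr.
  by rewrite sumrB -scaler_suml v0 scale0r subr0 mulmx_sum_row.
rewrite /l1 mulr_suml.
apply: (@le_trans _ _ (\sum_j \sum_i `|v 0 i| *
    `|(row i (A ^+ t) - row 0 (A ^+ t)) 0 j|)).
  apply: ler_sum => j _; rewrite summxE.
  apply: le_trans (ler_norm_sum _ _ _) _.
  by apply: ler_sum => i _; rewrite mxE normrM.
rewrite exchange_big/=; apply: ler_sum => i _.
by rewrite -mulr_sumr ler_wpM2l// mix_dist_ub.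
Qed.

Lemma stochasticX {R : realType} {n} (A : 'M[R]_n) t :
  stochastic A -> stochastic (A ^+ t).
Proof.
move=> [A0 A1]; elim: t => [|t [IH0 IH1]].
  split=> [i j|i]; first by rewrite expr0 !mxE; case: eqP.
  rewrite expr0 (bigD1 i)//= big1 ?mxE ?eqxx ?addr0// => j ji.
  by rewrite !mxE eq_sym (negbTE ji).
split=> [i j|i].
  by rewrite exprS mxE sumr_ge0// => k _; rewrite mulr_ge0.
rewrite exprS; under eq_bigr do rewrite mxE.
rewrite exchange_big/=; under eq_bigr do rewrite -mulr_sumr IH1 mulr1.
exact: A1.
Qed.

Lemma l1_stochastic {R : realType} {n} (A : 'M[R]_n) i :
  stochastic A -> l1 (row i A) = 1.
Proof.
by move=> [A0 A1]; rewrite -(A1 i); apply: eq_bigr => j _; rewrite mxE ger0_norm.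
Qed.

Lemma l1B {R : realType} {n} (u v : 'rV[R]_n) : l1 (u - v) <= l1 u + l1 v.
Proof.
by rewrite /l1 -big_split; apply: ler_sum => j _; rewrite !mxE ler_normB.
Qed.

Lemma mix_dist_le2 {R : realType} {n} (A : 'M[R]_n) t :
  stochastic A -> mix_dist A t <= 2.
Proof.
move=> sA; apply: mix_dist_le => // i j.
by apply: le_trans (l1B _ _) _; rewrite !l1_stochastic//; exact: stochasticX.
Qed.

Lemma sum_rowB {R : realType} {n} (A : 'M[R]_n) i j : stochastic A ->
  \sum_k (row i A - row j A) 0 k = 0.
Proof.
move=> [_ A1]; under eq_bigr do rewrite !mxE.
by rewrite sumrB !A1 subrr.
Qed.

(** A difference of rows of [A ^+ (s + t)] is the corresponding difference for [A ^+ s], whose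
    entries sum to zero, multiplied by [A ^+ t]. *)
Lemma mix_distD {R : realType} {n} (A : 'M[R]_n) s t : stochastic A ->
  mix_dist A (s + t) <= mix_dist A s * mix_dist A t.
Proof.
move=> sA; apply: mix_dist_le; first by rewrite mulr_ge0 ?mix_dist_ge0.
move=> i j; rewrite exprD !row_mul -mulmxBl.
apply: le_trans (l1_mul_mix_dist _ _ _ _) _.
  exact/sum_rowB/stochasticX.
by rewrite ler_wpM2r ?mix_dist_ge0// mix_dist_ub.
Qed.

Lemma inv_expR1_le {R : realType} : (expR 1)^-1 <= 2^-1 :> R.
Proof. by rewrite lef_pV2 ?posrE ?expR_gt0//; exact: expR_ge1Dx. Qed.

(* With [S N] the partial sum, submultiplicativity gives
   [S N <= S (N + t) <= 2 t + S N / e]. *)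
Lemma sum_mix_dist {R : realType} {n} (A : 'M[R]_n) t N : stochastic A ->
  mix_dist A t <= (expR 1)^-1 -> \sum_(k < N) mix_dist A k <= 4 * t%:R.
Proof.
move=> sA At; set S := \sum_(k < N) _.
have S0 : 0 <= S by apply: sumr_ge0 => k _; exact: mix_dist_ge0.
have le1 : S <= \sum_(k < t + N) mix_dist A k.
  rewrite addnC big_split_ord/= lerDl.
  by apply: sumr_ge0 => k _; exact: mix_dist_ge0.
(* The first [t] terms are at most 2 each. Weakening 1/e to 1/2 on the others leaves S <= 2 t + S /
   2, whence the constant 4. *)
have le2 : \sum_(k < t + N) mix_dist A k <= 2 * t%:R + S / 2.
  rewrite big_split_ord/= lerD//.
    rewrite mulr_natr -[t in leRHS]card_ord -sumr_const.
    by apply: ler_sum => k _; exact: mix_dist_le2.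
  rewrite mulr_suml; apply: ler_sum => k _ /=.
  rewrite addnC; apply: le_trans (mix_distD _ _ _ sA) _.
  by rewrite ler_wpM2l ?mix_dist_ge0// (le_trans At)// inv_expR1_le.
by have := le_trans le1 le2; lra.
Qed.

(** * Primitive matrices have a finite mixing time *)

(** The least positive gap [g] between two elements of [S] must divide every element of [S], hence
    equals 1. Two consecutive elements [b] and [b + 1] then generate all large integers. *)
Lemma semigroup_cofinite (S : nat -> Prop) :
  S 0%N -> (forall a b, S a -> S b -> S (a + b)%N) ->
  (forall d, (forall k, S k -> (d %| k)%N) -> d = 1%N) ->
  exists K, forall k, (K <= k)%N -> S k.
Proof.
move=> S0 SD Sgcd.
have SM a q : S a -> S (q * a)%N.
  by move=> Sa; elim: q => [|q IH]; [rewrite mul0n|rewrite mulSn; exact: SD].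
pose D := fun g : nat => (0 < g)%N && `[< exists b, S b /\ S (b + g)%N >].
(* Without a positive gap [S] contains only 0, and 2 would be a common divisor. *)
have exD : exists g, D g.
  apply/not_existsP => noD; suff: 2%N = 1%N by [].
  apply: Sgcd => -[//|k] Sk; exfalso; apply: (noD k.+1).
  by rewrite /D/=; apply/asboolP; exists 0%N.
case: (ex_minnP exD) => g /andP[g0 /asboolP[b [Sb Sbg]]] gmin.
have g1 : g = 1%N.
  apply: Sgcd => k Sk; rewrite /dvdn; apply: contraT; rewrite -lt0n => r0.
  suff /gmin : D (k %% g)%N by rewrite leqNgt ltn_pmod.
  (* A nonzero remainder of [k] modulo [g] would be a smaller gap: with q = k / g, both q (b + g)
     and q b + k lie in [S] and differ by that remainder. *)
  rewrite /D r0; apply/asboolP; exists (k %/ g * (b + g))%N; split.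
    exact: SM.
  have -> : (k %/ g * (b + g) + k %% g = k %/ g * b + k)%N.
    by rewrite mulnDr -addnA -divn_eq.
  by apply: SD => //; exact: SM.
rewrite {}g1 addn1 in Sbg.
exists (b * b)%N => k kb.
have [b0|b0] := posnP b; first by rewrite -[k]muln1; apply: SM; rewrite -b0.
(* The second coefficient is a true difference: [b * b <= k] makes the quotient at least [b], which
   exceeds the remainder. *)
have -> : k = (k %% b * b.+1 + (k %/ b - k %% b) * b)%N.
  rewrite mulnBl mulnS -addnA subnKC; first by rewrite addnC -divn_eq.
  rewrite leq_mul2r; apply/orP; right.
  by apply: leq_trans (ltnW (ltn_pmod _ b0)) _; rewrite leq_divRL.
by apply: SD; exact: SM.
Qed.

Lemma stochasticX_gt0 {R : realType} {n} (A : 'M[R]_n) s t i j k :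
  stochastic A -> 0 < (A ^+ s) i j -> 0 < (A ^+ t) j k ->
  0 < (A ^+ (s + t)) i k.
Proof.
move=> sA As At; rewrite exprD mxE (bigD1 j)//= ltr_wpDr ?mulr_gt0//.
by rewrite sumr_ge0// => l _; rewrite mulr_ge0 ?(stochasticX _ _ sA).1.
Qed.

Lemma path_gt0 {R : realType} {n} (A : 'M[R]_n) i s : stochastic A ->
  path (adj A) i s -> 0 < (A ^+ size s) i (last i s).
Proof.
move=> sA; elim: s i => [|j s IH] i /=; first by rewrite expr0 mxE eqxx ltr01.
by move=> /andP[ij /IH]; rewrite -addn1 addnC; apply: stochasticX_gt0.
Qed.

(** The return times to [i] form an additive semigroup with gcd 1, hence contain all large integers.
    Walks from the various [j] to [i] can thus be padded by closed walks at [i] to a common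
    length. *)
Lemma primitive_positive_column {R : realType} {n} (A : 'M[R]_n) (i : 'I_n) :
  stochastic A -> primitive A -> exists t, forall j, 0 < (A ^+ t) j i.
Proof.
move=> sA [conA aperA].
have walk j k : exists t, 0 < (A ^+ t) j k.
  by have /connectP[s sp ->] := conA j k; exists (size s); exact: path_gt0.
have [|a b|d dS|K HK] := @semigroup_cofinite (fun k => 0 < (A ^+ k) i i).
- by rewrite expr0 mxE eqxx ltr01.
- exact: stochasticX_gt0.
(* Aperiodicity concerns cycles at every vertex. A cycle at [j] is inserted into a closed walk at
   [i] through [j]; a common divisor [d] of both return times divides the length of the cycle. *)
- apply: aperA => j s sp lastj _.
  have := path_gt0 _ _ _ sA sp; rewrite lastj => Aj.
  have [a Aa] := walk i j; have [b Ab] := walk j i.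
  have /dS dab : 0 < (A ^+ (a + b)) i i by exact: stochasticX_gt0 Aa Ab.
  have /dS : 0 < (A ^+ (a + size s + b)) i i.
    by apply: stochasticX_gt0 Ab => //; exact: stochasticX_gt0 Aa Aj.
  by rewrite addnAC dvdn_addr.
have [f Hf] := choice (fun j => walk j i).
(* After the [f j] steps from [j] to [i], at least [K] steps remain. *)
exists (\max_j f j + K)%N => j.
have fj := leq_bigmax j (F := f).
rewrite -(subnKC (leq_trans fj (leq_addr K _))).
apply: stochasticX_gt0 (Hf j) _ => //; apply: HK.
by rewrite addnC -addnBA// leq_addr.
Qed.

(* Doeblin's argument: subtracting the constant [a] from column [i] does not
   change [v M] when the entries of [v] sum to zero. *)
Lemma doeblin_contraction {R : realType} {n} (M : 'M[R]_n) (i : 'I_n) a :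
  stochastic M -> (forall k, a <= M k i) ->
  forall v : 'rV_n, \sum_k v 0 k = 0 -> l1 (v *m M) <= (1 - a) * l1 v.
Proof.
move=> [M0 M1] Ma v v0.
pose N k j := M k j - (j == i)%:R * a.
have N0 k j : 0 <= N k j.
  by rewrite /N; case: eqP => [->|_]; rewrite ?mul1r ?mul0r ?subr0// subr_ge0.
have N1 k : \sum_j N k j = 1 - a.
  rewrite sumrB M1 (bigD1 i)//= eqxx mul1r big1 ?addr0// => j /negbTE ->.
  by rewrite mul0r.
have vN j : (v *m M) 0 j = \sum_k v 0 k * N k j.
  rewrite mxE; under [RHS]eq_bigr do rewrite mulrBr.
  by rewrite sumrB -mulr_suml v0 mul0r subr0.
rewrite /l1 mulr_sumr.
apply: (@le_trans _ _ (\sum_j \sum_k `|v 0 k| * N k j)).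
  apply: ler_sum => j _; rewrite vN; apply: le_trans (ler_norm_sum _ _ _) _.
  by apply: ler_sum => k _; rewrite normrM (ger0_norm (N0 _ _)).
rewrite exchange_big/=; apply: ler_sum => k _.
by rewrite -mulr_sumr N1 mulrC.
Qed.

(** A power [M] of [A] has a positive column, so by Doeblin's argument its powers contract zero-sum
    vectors geometrically, in particular differences of rows of the identity. *)
Lemma primitive_mixing {R : realType} {n} (A : 'M[R]_n) : (0 < n)%N ->
  stochastic A -> primitive A -> exists t, mix_pred A t.
Proof.
move=> n0 sA pA; pose i := Ordinal n0.
have [t At] := primitive_positive_column _ i sA pA.
have sM := stochasticX _ t sA; set M := A ^+ t in At sM.
(* The initial value 1 of the minimum gives [a <= 1], so the contraction factor [1 - a] is
   nonnegative. *)
pose a := \big[Num.min/1]_k M k i.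
have a0 : 0 < a by apply: lt_bigmin => // k _.
have aM k : a <= M k i by exact: bigmin_le.
have a1 : a <= 1 by exact: bigmin_le_id.
have sum0 m (v : 'rV[R]_n) : \sum_k v 0 k = 0 ->
    \sum_k (v *m M ^+ m) 0 k = 0.
  move=> v0; under eq_bigr do rewrite mxE.
  rewrite exchange_big/=; under eq_bigr do
    rewrite -mulr_sumr (stochasticX _ _ sM).2 mulr1.
  exact: v0.
have contr m (v : 'rV[R]_n) : \sum_k v 0 k = 0 ->
    l1 (v *m M ^+ m) <= (1 - a) ^+ m * l1 v.
  move=> v0; elim: m => [|m IH]; first by rewrite !expr0 mulmx1 mul1r.
  rewrite exprSr mulmxA exprS -mulrA.
  apply: le_trans (doeblin_contraction _ i a sM aM _ (sum0 _ _ v0)) _.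
  by rewrite ler_wpM2l// subr_ge0.
have : (1 - a) ^+ m @[m --> \oo] --> 0.
  by apply: cvg_expr; rewrite ger0_norm ?subr_ge0//; lra.
(* The factor 1/2 compensates for the distance between two rows of the identity, which is at most
   2. *)
have e0 : 0 < (expR 1)^-1 / 2 :> R by rewrite divr_gt0// invr_gt0 expR_gt0.
move=> /cvgr0Pnorm_le/(_ _ e0)[m _ /(_ m (leqnn _))] /=.
rewrite ger0_norm; last by rewrite exprn_ge0// subr_ge0.
rewrite ler_pdivlMr// => am.
exists (t * m)%N; rewrite /mix_pred.
apply: mix_dist_le => [|j k]; first by rewrite invr_ge0 expR_ge0.
rewrite exprM -/M -[M ^+ m]mul1mx !row_mul -mulmxBl.
apply: le_trans am; apply: le_trans (contr _ _ _) _.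
  by rewrite -[X in row j X](expr0 A) -[X in row k X](expr0 A);
     exact/sum_rowB/stochasticX.
rewrite ler_wpM2l//; first by rewrite exprn_ge0// subr_ge0.
rewrite -[X in row j X](expr0 A) -[X in row k X](expr0 A).
by apply: le_trans (l1B _ _) _; rewrite !l1_stochastic//; exact: stochasticX.
Qed.

(** The default branch of [tau_mix] is excluded by [primitive_mixing]. *)
Lemma mix_dist_tau {R : realType} {n} (A : 'M[R]_n) : (0 < n)%N ->
  stochastic A -> primitive A -> mix_dist A (tau_mix A) <= (expR 1)^-1.
Proof.
move=> n0 sA pA; rewrite /tau_mix; case: pselect => [H|]; last first.
  by have := primitive_mixing _ n0 sA pA.
by case: ex_minnP.
Qed.

(** At time 0, two distinct rows of the identity are further apart than 1/e. In [tail_bound] this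
    absorbs the contribution of the reference variable into the product with [tau_mix]. *)
Lemma tau_mix_gt0 {R : realType} {n} (A : 'M[R]_n) : (1 < n)%N ->
  stochastic A -> primitive A -> (0 < tau_mix A)%N.
Proof.
move=> n1 sA pA; rewrite lt0n; apply/eqP => tau0.
have n0 : (0 < n)%N by exact: ltnW.
have := mix_dist_tau _ n0 sA pA; rewrite {}tau0 leNgt => /negP; apply.
pose i := Ordinal n0; pose j := Ordinal n1.
apply: (@lt_le_trans _ _ 1).
  by rewrite invf_lt1 ?expR_gt0// expR_gt1.
apply: le_trans (mix_dist_ub _ _ i j); rewrite expr0.
rewrite /l1 (bigD1 i)//= !mxE/= subr0 normr1 lerDl.
exact: sumr_ge0.
Qed.

(** * The averaging weights *)

Definition weights {R : realType} {n} (A : 'M[R]_n) k : 'rV[R]_n :=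
  const_mx n%:R^-1 *m A ^+ k.

Lemma weightsE {R : realType} {n} (A : 'M[R]_n) k j :
  weights A k 0 j = \sum_i n%:R^-1 * (A ^+ k) i j.
Proof. by rewrite mxE; apply: eq_bigr => i _; rewrite mxE. Qed.

Lemma trajE {R : realType} {n} (A : 'M[R]_n) x k : traj A x k = A ^+ k *m x.
Proof.
by elim: k => [|k IH]; [rewrite expr0 mul1mx|rewrite exprS -mulmxA -IH].
Qed.

Lemma aveE {R : realType} {n} (x : 'cV[R]_n) :
  ave x = ((const_mx n%:R^-1 : 'rV_n) *m x) 0 0.
Proof. by rewrite /ave mulr_sumr mxE; apply: eq_bigr => i _; rewrite mxE. Qed.

Section Weights.
Context {R : realType} {n : nat} (A : 'M[R]_n).
Hypotheses (n0 : (0 < n)%N) (sA : stochastic A).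

Lemma weights_ge0 k j : 0 <= weights A k 0 j.
Proof.
rewrite weightsE sumr_ge0// => i _; rewrite mulr_ge0 ?invr_ge0//.
exact: (stochasticX _ _ sA).1.
Qed.

Lemma sum_weights k : \sum_j weights A k 0 j = 1.
Proof.
under eq_bigr do rewrite weightsE.
rewrite exchange_big/=.
under eq_bigr do rewrite -mulr_sumr (stochasticX _ _ sA).2 mulr1.
by rewrite sumr_const card_ord -[LHS]mulr_natr mulVf// pnatr_eq0 -lt0n.
Qed.

(** The weights are the column sums of the nonnegative matrix (1/n) A^k. As they add up to 1, the
    set under [sup] is bounded by 1, so its supremum is a genuine upper bound. *)
Lemma weights_le k j : weights A k 0 j <= sup_pow_norm1 A.
Proof.
have wj m i : \sum_k `|(n%:R^-1 *: A ^+ m) k i| = weights A m 0 i.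
  rewrite weightsE; apply: eq_bigr => l _; rewrite mxE ger0_norm// mulr_ge0 ?invr_ge0//.
  exact: (stochasticX _ _ sA).1.
apply: (@le_trans _ _ (norm1 (n%:R^-1 *: A ^+ k))).
  by rewrite -wj; apply: le_bigmax.
apply: ub_le_sup; last by exists k.
exists 1 => _ [m _ <-]; apply: bigmax_le => // i _; rewrite wj.
rewrite -(sum_weights m) (bigD1 i)//= lerDl sumr_ge0// => l _.
exact: weights_ge0.
Qed.

Lemma sup_pow_norm1_ge0 : 0 <= sup_pow_norm1 A.
Proof.
exact: le_trans (weights_ge0 0 (Ordinal n0)) (weights_le 0 (Ordinal n0)).
Qed.

Lemma sum_weights_sqr k : \sum_j weights A k 0 j ^+ 2 <= sup_pow_norm1 A.
Proof.
rewrite -[leRHS]mulr1 -(sum_weights k) mulr_sumr.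
by apply: ler_sum => j _; rewrite expr2 ler_wpM2r ?weights_ge0 ?weights_le.
Qed.

(** The difference is a zero-sum vector of norm at most 2 multiplied by [A ^+ k], which controls its
    [l1] norm; the supremum bound on its entries passes from [l1] to squares. *)
Lemma sum_weightsB_sqr k N : (k <= N)%N ->
  \sum_j (weights A N - weights A k) 0 j ^+ 2 <=
  2 * sup_pow_norm1 A * mix_dist A k.
Proof.
move=> kN; set v := weights A N - weights A k.
have l1v : l1 v <= 2 * mix_dist A k.
  have -> : v = (weights A (N - k) - weights A 0) *m A ^+ k.
    rewrite mulmxBl /weights -!mulmxA expr0 mul1mx.
    by have -> : A ^+ (N - k) *m A ^+ k = A ^+ N by rewrite -[LHS]exprD subnK.
  apply: le_trans (l1_mul_mix_dist _ _ _ _) _.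
    under eq_bigr do rewrite mxE [X in _ + X]mxE.
    by rewrite sumrB !sum_weights subrr.
  rewrite ler_wpM2r ?mix_dist_ge0//; apply: le_trans (l1B _ _) _.
  have l1w m : l1 (weights A m) = 1.
    rewrite -(sum_weights m); apply: eq_bigr => j _.
    by rewrite ger0_norm// weights_ge0.
  by rewrite !l1w.
(* Both weights lie between 0 and [sup_pow_norm1 A], hence so does the absolute value of each entry
   of [v]. *)
rewrite mulrAC mulrC.
apply: le_trans (ler_wpM2l sup_pow_norm1_ge0 l1v).
rewrite /l1 mulr_sumr; apply: ler_sum => j _.
rewrite -real_normK ?num_real// expr2 ler_wpM2r//.
have := weights_ge0 N j; have := weights_ge0 k j.
have := weights_le N j; have := weights_le k j.
by rewrite !mxE ler_norml; lra.
Qed.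

Lemma ave_traj mu (x : 'I_n -> R) k :
  ave (traj A (\col_i (mu + x i)) k) - mu = \sum_j weights A k 0 j * x j.
Proof.
rewrite trajE aveE mulmxA -/(weights A k) mxE.
under eq_bigr do rewrite [X in _ * X]mxE mulrDr.
by rewrite big_split/= -mulr_suml sum_weights mul1r addrAC subrr add0r.
Qed.

End Weights.

(** * Centred Gaussian laws: second moment, symmetry, vanishing covariance *)

Lemma measurable_sqr_EFin {R : realType} :
  measurable_fun [set: R] (fun x : R => (x ^+ 2)%:E : \bar R).
Proof. by apply/measurable_EFinP; exact: exprn_measurable. Qed.

(* [x ^ 2] is absorbed by doubling the standard deviation. *)
Lemma sqr_normal_pdf_le {R : realType} (s x : R) : s != 0 ->
  x ^+ 2 * normal_pdf 0 s x <=
  8 * s ^+ 2 / 3 * normal_peak s / normal_peak (2 * s) * normal_pdf 0 (2 * s) x.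
Proof.
move=> s0; have s2 : 0 < s ^+ 2 by rewrite exprn_even_gt0.
have t0 : 2 * s != 0 by rewrite mulf_neq0// pnatr_eq0.
have pt0 := normal_peak_gt0 t0.
rewrite !normal_pdfE//= /normal_fun !subr0 [leRHS]mulrA divfK ?gt_eqF//.
rewrite mulrCA -[leRHS]mulrA [leRHS]mulrCA.
rewrite ler_wpM2l ?normal_peak_ge0//.
(* The gap between the two Gaussian exponents, as 1/2 - 1/8 = 3/8; then u e^(-u) <= 1 removes the
   square. *)
pose u := 3 * x ^+ 2 / (8 * s ^+ 2).
have -> : - x ^+ 2 / (s ^+ 2 *+ 2) = - x ^+ 2 / ((2 * s) ^+ 2 *+ 2) + - u.
  by rewrite /u; field; rewrite s0.
rewrite expRD [leLHS]mulrCA [leRHS]mulrC ler_wpM2l ?expR_ge0//.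
have -> : x ^+ 2 = 8 * s ^+ 2 / 3 * u by rewrite /u; field; rewrite s0.
have ue : u * expR (- u) <= 1.
  rewrite expRN ler_pdivrMr ?expR_gt0// mul1r.
  by apply: le_trans (expR_ge1Dx u); rewrite lerDr.
by rewrite -[leRHS]mulr1 -[leLHS]mulrA ler_wpM2l// divr_ge0// mulr_ge0// ltW.
Qed.

(** The integral is moved to Lebesgue measure, where a multiple of the density with standard
    deviation [2 * s] dominates the integrand. *)
Lemma normal_second_moment {R : realType} (s : R) : s != 0 ->
  (\int[normal_prob 0 s]_x (x ^+ 2)%:E < +oo)%E.
Proof.
move=> s0; have dom := normal_prob_dominates 0 s.
pose p t (x : R) : \bar R := (normal_pdf 0 t x)%:E.
have mp t : measurable_fun [set: R] (p t).
  by apply/measurable_EFinP; exact: measurable_normal_pdf.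
have := @Radon_Nikodym_SigmaFinite.change_of_variables _ _ _
  (normal_prob 0 s) lebesgue_measure dom (fun x : R => (x ^+ 2)%:E : \bar R) setT
  (fun x => sqr_ge0 x) measurableT measurable_sqr_EFin.
set f := Radon_Nikodym_SigmaFinite.f _ _ => /= <-.
have intf : lebesgue_measure.-integrable setT f.
  exact: Radon_Nikodym_SigmaFinite.f_integrable.
rewrite (@ae_eq_integral _ (measurableTypeR R) R lebesgue_measure setT
  (fun x : R => (x ^+ 2)%:E * p s x)%E)//; last 3 first.
- by apply: emeasurable_funM; [exact: measurable_sqr_EFin|exact: measurable_int intf].
- by apply: emeasurable_funM; [exact: measurable_sqr_EFin|exact: mp].
(* The abstract Radon-Nikodym derivative agrees almost everywhere with the explicit density, both
   having the same integral over every measurable set. *)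
- apply: ae_eqe_mul2l; apply: integral_ae_eq; [by []|exact: intf|exact: mp|].
  by move=> E _ mE; rewrite -Radon_Nikodym_SigmaFinite.f_integral.
pose C := 8 * s ^+ 2 / 3 * normal_peak s / normal_peak (2 * s).
apply: (@le_lt_trans _ _ (\int[lebesgue_measure]_x (C%:E * p (2 * s)%R x))%E).
  apply: ge0_le_integral => //.
  - by move=> x _; rewrite mule_ge0// lee_fin ?sqr_ge0 ?normal_pdf_ge0.
  - by apply: emeasurable_funM; [exact: measurable_sqr_EFin|exact: mp].
  - by apply: measurable_funeM; exact: mp.
  - by move=> x _; rewrite -!EFinM lee_fin sqr_normal_pdf_le.
rewrite integralZl//; last exact: integrable_normal_pdf.
by rewrite integral_normal_pdf mule1 ltry.
Qed.

(** The density is even and Lebesgue measure is invariant under reflection; a point mass at 0 is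
    symmetric too. *)
Lemma gauss_law_sym {R : realType} (s : R) (A : set R) : measurable A ->
  gauss_law 0 s (-%R @^-1` A) = gauss_law 0 s A.
Proof.
move=> mA; rewrite /gauss_law; case: eqP => [_|/eqP s0].
  by rewrite !diracE; congr (_%:R%:E); congr nat_of_bool; apply/idP/idP;
    rewrite !inE /= oppr0.
have mp : measurable_fun [set: R] (fun x : R => (normal_pdf 0 s x)%:E : \bar R).
  by apply/measurable_EFinP; exact: measurable_normal_pdf.
rewrite /normal_prob.
transitivity (\int[pushforward lebesgue_measure (-%R : _ -> measurableTypeR R)]_(x in A)
   (normal_pdf 0 s x)%:E)%E; last first.
  by apply: eq_measure_integral => B mB _; exact: lebesgue_measureN.
rewrite ge0_integral_pushforward//=.
- apply: eq_integral => x _; rewrite !normal_pdfE// /normal_fun !subr0.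
  by rewrite sqrrN.
- exact: measurable_funTS.
- by move=> x _; rewrite lee_fin normal_pdf_ge0.
Qed.

(** [V] is chosen before [X]: one value serves all coordinates in all dimensions. *)
Lemma gauss_second_moment {R : realType} (s : R) d (T : measurableType d)
    (Pr : probability T R) :
  exists V, 0 <= V /\ forall X : {RV Pr >-> R},
    (forall A : set R, measurable A -> Pr (X @^-1` A) = gauss_law 0 s A) ->
    (\int[Pr]_w (X w ^+ 2)%:E = V%:E)%E.
Proof.
have sqr0 (x : R) : (0 <= (x ^+ 2)%:E)%E by rewrite lee_fin sqr_ge0.
have msqr := @measurable_sqr_EFin R.
(* Lebesgue integrals live on [measurableTypeR R], whose display differs from
   that of [R]. *)
have law (X : {RV Pr >-> R}) (Q : {measure set (measurableTypeR R) -> \bar R}) :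
    (forall A : set R, measurable A -> Pr (X @^-1` A) = Q A) ->
    (\int[Pr]_w (X w ^+ 2)%:E = \int[Q]_x (x ^+ 2)%:E)%E.
  move=> XQ.
  have mX : measurable_fun setT (X : T -> measurableTypeR R).
    exact: (measurable_funP X).
  pose Y : {mfun T >-> measurableTypeR R} :=
    HB.pack_for {mfun T >-> measurableTypeR R} (X : T -> measurableTypeR R)
    (isMeasurableFun.Build _ _ _ _ _ mX).
  transitivity (\int[distribution Pr Y]_x (x ^+ 2)%:E)%E.
    by rewrite ge0_integral_distribution.
  by apply: eq_measure_integral => A mA _; exact: XQ.
have [->|s0] := eqVneq s 0.
  exists 0; split=> // X HX.
  rewrite (law X (@dirac _ (measurableTypeR R) (0%R : R) R)); last first.
    by move=> A mA; rewrite HX// /gauss_law eqxx.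
  rewrite integral_dirac//.
  by rewrite expr0n/= diracE mem_set// mul1e.
exists (fine (\int[normal_prob 0 s]_x (x ^+ 2)%:E)); split.
  by apply/fine_ge0/integral_ge0.
move=> X HX; rewrite (law X (normal_prob 0 s)); last first.
  by move=> A mA; rewrite HX// /gauss_law (negbTE s0).
by rewrite fineK// ge0_fin_numE ?normal_second_moment// integral_ge0.
Qed.

(* The laws of [(X, Y)] and [(- X, Y)] agree on rectangles, hence everywhere,
   so that E[X Y] = - E[X Y]. *)
Lemma integral_mul_sym_indep {R : realType} d (T : measurableType d)
    (Pr : probability T R) (X Y : {RV Pr >-> R}) :
  (forall A : set R, measurable A -> Pr (X @^-1` (-%R @^-1` A)) = Pr (X @^-1` A)) ->
  (forall A B : set R, measurable A -> measurable B ->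
    Pr (X @^-1` A `&` Y @^-1` B) = (Pr (X @^-1` A) * Pr (Y @^-1` B))%E) ->
  Pr.-integrable setT (fun w => (X w * Y w)%:E) ->
  (\int[Pr]_w (X w * Y w)%:E = 0)%E.
Proof.
move=> symX indXY intXY.
pose f : R * R -> \bar R := fun z => (z.1 * z.2)%:E.
have mf : measurable_fun setT f.
  by apply/measurable_EFinP; exact: measurable_funM.
have mopp : measurable_fun [set: R] (-%R : R -> R) by exact: oppr_measurable.
have mZ : measurable_fun setT (fun w => (X w, Y w) : R * R).
  exact: measurable_fun_pair.
have mZ' : measurable_fun setT (fun w => (- X w, Y w) : R * R).
  apply: measurable_fun_pair => //; exact: measurableT_comp.
pose Z : {mfun T >-> (R * R)%type} := HB.pack_for {mfun T >-> (R * R)%type}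
  (fun w => (X w, Y w) : R * R) (isMeasurableFun.Build _ _ _ _ _ mZ).
pose Z' : {mfun T >-> (R * R)%type} := HB.pack_for {mfun T >-> (R * R)%type}
  (fun w => (- X w, Y w) : R * R) (isMeasurableFun.Build _ _ _ _ _ mZ').
have prodZ (A : set (R * R)) : measurable A ->
    distribution Pr Z A = distribution Pr Z' A.
  move=> mA.
  transitivity ((distribution Pr X \x distribution Pr Y)%E A).
    by apply/esym/product_measure_unique => // B C mB mC; exact: indXY.
  apply: product_measure_unique => // B C mB mC.
  transitivity (Pr (X @^-1` (-%R @^-1` B) `&` Y @^-1` C)); first by [].
  rewrite indXY//; last by rewrite -[X in measurable X]setTI; exact: mopp.
  by rewrite symX.
have E : (\int[Pr]_w (X w * Y w)%:E = \int[Pr]_w (- (X w * Y w))%:E)%E.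
  transitivity (\int[distribution Pr Z]_z f z)%E.
    by rewrite integral_distribution.
  transitivity (\int[distribution Pr Z']_z f z)%E.
    by apply: eq_measure_integral => A mA _; exact: prodZ.
  have -> : (fun w => (- (X w * Y w))%:E) = f \o Z'.
    by apply/funext => w; rewrite /f /= mulNr.
  rewrite integral_distribution//.
  have -> : f \o Z' = (fun w => - (X w * Y w)%:E)%E.
    by apply/funext => w; rewrite /f /= mulNr EFinN.
  exact: integrableN.
move: E; under [in RHS]eq_integral do rewrite EFinN.
rewrite integralN//=; last exact: integrable_add_def.
have := integrable_fin_num measurableT intXY.
by case: (integral _ _ _) => // r _ [rN]; congr EFin; lra.
Qed.

(** * Variance and tails of linear combinations *)

Lemma mutually_independent_pair {R : realType} d (T : measurableType d)
    (Pr : probability T R) n (X : 'I_n -> {RV Pr >-> R}) i j (A B : set R) :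
  mutually_independent X -> i != j -> measurable A -> measurable B ->
  Pr (X i @^-1` A `&` X j @^-1` B) = (Pr (X i @^-1` A) * Pr (X j @^-1` B))%E.
Proof.
move=> indX ij mA mB.
(* The full space at all other indices contributes factors 1. *)
pose C k := if k == i then A else if k == j then B else setT.
have mC k : measurable (C k) by rewrite /C; case: ifP => // _; case: ifP.
have Ci : C i = A by rewrite /C eqxx.
have Cj : C j = B by rewrite /C eq_sym (negbTE ij) eqxx.
have := indX C mC.
rewrite (bigD1 i)//= (bigD1 j)/=; last by rewrite eq_sym.
rewrite big1 ?mule1 ?Ci ?Cj => [<-|k /andP[ki kj]]; last first.
  by rewrite /C (negbTE ki) (negbTE kj) preimage_setT probability_setT.
congr (Pr _); apply/seteqP; split=> [w [wA wB] k _|w H].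
  by rewrite /= /C; case: eqP => [->//|_]; case: eqP => [->//|_].
by split; [have := H i I; rewrite /= Ci|have := H j I; rewrite /= Cj].
Qed.

Lemma integral_sqr_sum {R : realType} d (T : measurableType d)
    (Pr : probability T R) n (X : 'I_n -> {RV Pr >-> R}) V (v : 'I_n -> R) :
  (forall i, \int[Pr]_w (X i w ^+ 2)%:E = V%:E)%E ->
  (forall i j, i != j -> Pr.-integrable setT (fun w => (X i w * X j w)%:E) ->
    \int[Pr]_w (X i w * X j w)%:E = 0)%E ->
  (\int[Pr]_w ((\sum_i v i * X i w) ^+ 2)%:E = (V * \sum_i v i ^+ 2)%:E)%E.
Proof.
move=> varX covX.
have mXX i j : measurable_fun setT (fun w => (X i w * X j w)%:E : \bar R).
  by apply/measurable_EFinP; apply: measurable_funM; exact: measurable_funP.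
have intX2 i : Pr.-integrable setT (fun w => (X i w * X i w)%:E).
  apply/integrableP; split; first exact: mXX.
  under eq_integral do rewrite gee0_abs ?lee_fin -?expr2 ?sqr_ge0//.
  by rewrite varX ltry.
(* Domination by |x y| <= x^2 + y^2. *)
have intXX i j : Pr.-integrable setT (fun w => (X i w * X j w)%:E).
  apply: (@le_integrable _ _ _ _ _ measurableT _
    (fun w => (X i w * X i w)%:E + (X j w * X j w)%:E)%E) => //; last first.
    exact: integrableD.
  move=> w _; rewrite -EFinD lee_fin [leRHS]ger0_norm; last first.
    by rewrite addr_ge0// -expr2 sqr_ge0.
  rewrite ler_norml; set x := X i w; set y := X j w.
  by apply/andP; split; have := sqr_ge0 (x + y); have := sqr_ge0 (x - y);
    rewrite !expr2; have := sqr_ge0 x; have := sqr_ge0 y; rewrite !expr2; nra.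
have intv i j : Pr.-integrable setT
    (fun w => (v i * v j)%:E * (X i w * X j w)%:E)%E.
  exact: integrableZl.
transitivity (\int[Pr]_w \sum_i \sum_j (v i * v j)%:E * (X i w * X j w)%:E)%E.
  apply: eq_integral => w _; rewrite expr2 big_distrlr/= -sumEFin.
  apply: eq_bigr => i _; rewrite -sumEFin; apply: eq_bigr => j _.
  by rewrite -EFinM mulrACA.
rewrite integral_sum//; last by move=> i; exact: integrable_sum.
rewrite mulr_sumr -sumEFin; apply: eq_bigr => i _.
rewrite integral_sum// (bigD1 i)//= big1 ?adde0 => [|j ji].
  rewrite integralZl//; under eq_integral do rewrite -expr2.
  by rewrite varX -EFinM -expr2 mulrC.
by rewrite integralZl// covX 1?eq_sym// mule0.
Qed.

Lemma chebyshev_sum {R : realType} d (T : measurableType d)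
    (Pr : probability T R) n (X : 'I_n -> {RV Pr >-> R}) V (v : 'I_n -> R) e :
  0 < e ->
  (\int[Pr]_w ((\sum_i v i * X i w) ^+ 2)%:E = (V * \sum_i v i ^+ 2)%:E)%E ->
  (Pr [set w | (e <= `|\sum_i v i * X i w|)%R] <=
   (V / e ^+ 2 * \sum_i v i ^+ 2)%:E)%E.
Proof.
move=> e0 varY.
have mY : measurable_fun setT (fun w => \sum_i v i * X i w).
  apply: measurable_sum => i; apply: measurable_funM => //.
pose Y : {RV Pr >-> R} := HB.pack_for {mfun T >-> R}
  (fun w => \sum_i v i * X i w) (isMeasurableFun.Build _ _ _ _ _ mY).
have := @markov _ _ _ Pr Y (fun x => x ^+ 2) e e0 (exprn_measurable 2) _ _.
rewrite unlock /= => /(_ (fun r _ => sqr_ge0 r)) /(_ _)/wrap[|H].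
  by move=> x y; rewrite !nnegrE => x0 y0; rewrite ler_sqr.
have -> : V / e ^+ 2 * (\sum_i v i ^+ 2) = (e ^+ 2)^-1 * (V * \sum_i v i ^+ 2).
  by rewrite mulrAC mulrC.
rewrite EFinM lee_pdivlMl ?exprn_gt0// -varY.
under [leRHS]eq_integral do rewrite -real_normK ?num_real//.
exact: H.
Qed.

(** * The uniform tail bound and the conclusion *)

Lemma tail_bound {R : realType} d (T : measurableType d)
    (Pr : probability T R) n (A : 'M[R]_n) (X : 'I_n -> {RV Pr >-> R}) (V mu eps : R) :
  (1 < n)%N -> stochastic A -> primitive A -> 0 < eps -> 0 <= V ->
  (forall (v : 'I_n -> R) (e : R), (0 < e)%R ->
    Pr [set w | (e <= `|\sum_i v i * X i w|)%R] <=
    (V / e ^+ 2 * \sum_i v i ^+ 2)%:E)%E ->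
  (Pr [set w | exists k, (eps < `|ave (traj A (init mu X w) k) - mu|)%R ] <=
   (36 * V / eps ^+ 2 * (sup_pow_norm1 A * (tau_mix A)%:R))%:E)%E.
Proof.
move=> n1 sA pA eps0 V0 cheb; have n0 := ltnW n1.
set s := sup_pow_norm1 A; set tau := tau_mix A.
have s0 : 0 <= s := sup_pow_norm1_ge0 _ n0 sA.
pose Y (v : 'I_n -> R) w := \sum_i v i * X i w.
(* The flag [b] covers both the strict events in [F] and the non-strict ones in [H]. *)
have mlt (v : 'I_n -> R) (b : bool) c :
    measurable [set w | if b then c <= `|Y v w| else c < `|Y v w|].
  have mY : measurable_fun setT (fun w => `|Y v w|).
    apply: measurableT_comp => //; apply: measurable_sum => i.
    exact: measurable_funM.
  rewrite -[X in measurable X]setTI; case: b.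
    have := mY measurableT _ (measurable_itv `[c, +oo[).
    by congr (measurable (_ `&` _)); apply/seteqP; split=> w /=;
      rewrite in_itv/= andbT.
  have := mY measurableT _ (measurable_itv `]c, +oo[).
  by congr (measurable (_ `&` _)); apply/seteqP; split=> w /=;
    rewrite in_itv/= andbT.
pose w_ k i := weights A k 0 i.
(* These truncated events increase to the whole event, so by continuity from below a bound uniform
   in [N] suffices. *)
pose F N := [set w | exists2 k, (k <= N)%N & eps < `|Y (w_ k) w|].
have FE N : F N = \big[setU/set0]_(k < N.+1) [set w | eps < `|Y (w_ k) w|].
  rewrite -(bigcup_mkord _ (fun k => [set w | eps < `|Y (w_ k) w|])).
  apply/seteqP; split=> w /=.
    by move=> [k kN ek]; exists k.
  by move=> [k /= kN ek]; exists k.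
have mF N : measurable (F N).
  by rewrite FE; apply: bigsetU_measurable => k _; exact: (mlt _ false).
have -> : [set w | exists k, eps < `|ave (traj A (init mu X w) k) - mu| ] =
    \bigcup_N F N.
  apply/seteqP; split=> w /=.
    by move=> [k]; rewrite ave_traj// => ek; exists k => //; exists k.
  by move=> [N _ [k _ ek]]; exists k; rewrite ave_traj.
have Fnd : {homo F : a b / (a <= b)%N >-> (a <= b)%O}.
  move=> a b ab; apply/subsetPset => w [k ka ek].
  by exists k => //; exact: leq_trans ab.
have cvgF := nondecreasing_cvg_mu mF (bigcup_measurable (fun N _ => mF N)) Fnd
  (mu := Pr).
rewrite -(cvg_lim (@ereal_hausdorff _) cvgF).
apply: lime_le; first by apply/cvg_ex; eexists; exact: cvgF.
apply: nearW => N /=.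
(* Slot [N] holds the reference variable itself, the others its increments. If some |Y (w_ k)|
   exceeds [eps], either the reference or an increment reaches [eps / 2]. *)
pose v k i := if k == N then w_ N i else w_ N i - w_ k i.
pose H k := [set w | eps / 2 <= `|Y (v k) w|].
have mH k : measurable (H k) by exact: (mlt _ true).
have FH : F N `<=` \big[setU/set0]_(k < N.+1) H k.
  move=> w [k kN ek]; rewrite -bigcup_mkord.
  have [kNe|kNn] := eqVneq k N.
    by exists N => //=; rewrite /H/= /v eqxx -/(w_ N) -kNe; lra.
  have [wN|wN] := leP (eps / 2) `|Y (w_ N) w|.
    by exists N => //=; rewrite /H/= /v eqxx.
  exists k => //=; rewrite /H/= /v (negbTE kNn).
  have -> : Y (fun i => w_ N i - w_ k i) w = Y (w_ N) w - Y (w_ k) w.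
    by rewrite /Y -sumrB; apply: eq_bigr => i _; rewrite mulrBl.
  have := lerB_dist (Y (w_ k) w) (Y (w_ N) w); rewrite distrC; lra.
apply: le_trans (content_subadditive _ _ (mF N) FH) _; first by move=> k _.
pose c k := if k == N then s else 2 * s * mix_dist A k.
have vc k : (k <= N)%N -> \sum_i v k i ^+ 2 <= c k.
  move=> kN; rewrite /v /c; case: eqP => _; first exact: sum_weights_sqr.
  apply: le_trans (sum_weightsB_sqr _ n0 sA _ _ kN).
  by apply: ler_sum => i _; rewrite [X in _ <= X ^+ 2]mxE [X in _ <= (_ + X) ^+ 2]mxE.
have K0 : 0 <= V / (eps / 2) ^+ 2 by rewrite divr_ge0// exprn_ge0// ltW// divr_gt0.
apply: (@le_trans _ _ (\sum_(k < N.+1) (V / (eps / 2) ^+ 2 * c k)%:E)%E).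
  apply: lee_sum => k _; apply: le_trans (cheb _ _ _) _; first by rewrite divr_gt0.
  by rewrite lee_fin ler_wpM2l// vc// -ltnS.
rewrite sumEFin lee_fin -mulr_sumr big_ord_recr/= {2}/c eqxx.
have -> : \sum_(k < N) c k = 2 * s * \sum_(k < N) mix_dist A k.
  rewrite mulr_sumr; apply: eq_bigr => k _; rewrite /c.
  by rewrite (ltn_eqF (ltn_ord k)).
have S : \sum_(k < N) mix_dist A k <= 4 * tau%:R.
  by apply: sum_mix_dist => //; exact: mix_dist_tau.
have tau1 : 1 <= tau%:R :> R by rewrite ler1n tau_mix_gt0.
(* 36 = 4 * 9: the 4 comes from halving [eps], the 9 from 8 s tau for the increments plus s <= s tau
   for the reference. *)
have -> : 36 * V / eps ^+ 2 * (s * tau%:R) = V / (eps / 2) ^+ 2 * (9 * (s * tau%:R)).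
  by field; rewrite gt_eqF.
rewrite ler_wpM2l//.
have := ler_wpM2l s0 S; have := ler_wpM2l s0 tau1; lra.
Qed.

Theorem theorem2 (R : realType) (d : measure_display) (T : measurableType d)
  (Pr : probability T R) (mu sigma : R)
  (P : forall n : nat, 'M[R]_n) (xi : forall n : nat, 'I_n -> {RV Pr >-> R}) :
  (forall n, stochastic (P n)) ->
  (forall n, (0 < n)%N -> primitive (P n)) ->
  (forall n, mutually_independent (xi n)) ->
  (forall n (i : 'I_n) (A : set R), measurable A ->
      Pr (xi n i @^-1` A) = gauss_law 0 sigma A) ->
  (fun n => sup_pow_norm1 (P n) * (tau_mix (P n))%:R) @ \oo --> (0 : R) ->
  forall eps : R, 0 < eps ->
    (fun n => Pr [set w | exists k : nat,
                   eps < `|ave (traj (P n) (init mu (xi n) w) k) - mu| ])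
      @ \oo --> (0 : \bar R)%E.
Proof.
move=> sP pP indX lawX st0 eps eps0.
have [V [V0 VE]] := gauss_second_moment sigma d T Pr.
pose b n := 36 * V / eps ^+ 2 * (sup_pow_norm1 (P n) * (tau_mix (P n))%:R).
have cvgb : (fun n => (b n)%:E) @ \oo --> (0 : \bar R)%E.
  apply/fine_cvgP; split; first exact: nearW.
  by rewrite -(mulr0 (36 * V / eps ^+ 2)); apply: cvgMr.
(* From dimension 2 on, [tail_bound] applies. *)
apply: (squeeze_cvge _ (cvg_cst _) cvgb); exists 2%N => // n /= n2.
rewrite measure_ge0/=.
apply: tail_bound => //; first exact/pP/ltnW.
move=> v e e0; apply: chebyshev_sum => //; apply: integral_sqr_sum.
  by move=> i; apply: VE => A mA; exact: lawX.
(* Uncorrelatedness follows from the symmetry of the centred law and pairwise independence. *)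
move=> i j ij; apply: integral_mul_sym_indep => [A mA|A B mA mB].
  by rewrite !lawX// ?gauss_law_sym// -[X in measurable X]setTI; exact: oppr_measurable.
exact: mutually_independent_pair.
Qed.
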